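(* Let $c \geq 1$ be a real number and let $G$ be a (possibly infinite) graph whose growth satisfies $f_G(r) \leq cr$ for every positive integer $r$. Then $G$ has stack-number at most $49c^2+30c+1$.
   Context: Graphs are undirected and may be infinite. The growth of a graph $G$ is the function $f_G\colon \mathbb{N}\to\mathbb{N}\cup\{\infty\}$ where $f_G(r)$ is the supremum of $|V(H)|$ over all subgraphs $H$ of $G$ of radius at most $r$. For an integer $k$, a $k$-stack layout of $G$ is a pair $(\leq,\varphi)$ where $\leq$ is a linear ordering of $V(G)$ and $\varphi\colon E(G)\to\{1,\dots,k\}$ is a function such that $\varphi(ux)\neq\varphi(vy)$ for any two edges $ux,vy\in E(G)$ with $u<v<x<y$. The stack-number of $G$ is the minimum integer $k\geq 0$ such that $G$ has a $k$-stack layout, or $\infty$ if no such $k$ exists. *)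

(* Defs.v *)
From Stdlib Require Import Reals List.
Import ListNotations.
Open Scope R_scope.

Record graph (V : Type) : Type := {
  adj : V -> V -> Prop;
  adj_sym : forall u v, adj u v -> adj v u;
  adj_irrefl : forall v, ~ adj v v
}.
Arguments adj {V} g u v.

Definition is_subgraph {V : Type} (G : graph V) (S : V -> Prop) (E : V -> V -> Prop) : Prop :=
  (forall u v, E u v -> adj G u v /\ S u /\ S v) /\
  (forall u v, E u v -> E v u).

Inductive walk_le {V : Type} (E : V -> V -> Prop) : nat -> V -> V -> Prop :=
| walk_refl : forall n v, walk_le E n v v
| walk_step : forall n u v w, E u v -> walk_le E n v w -> walk_le E (S n) u w.

Definition radius_le {V : Type} (S : V -> Prop) (E : V -> V -> Prop) (r : nat) : Prop :=
  exists v, S v /\ forall u, S u -> walk_le E r v u.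

(* f_G(r) <= b : every subgraph of G of radius at most r has at most b vertices
   (in particular finitely many): every duplicate-free list of its vertices has length <= b. *)
Definition growth_le {V : Type} (G : graph V) (r : nat) (b : R) : Prop :=
  forall (S : V -> Prop) (E : V -> V -> Prop),
    is_subgraph G S E -> radius_le S E r ->
    forall l : list V, NoDup l -> (forall x, In x l -> S x) -> INR (length l) <= b.

Definition linear_order {V : Type} (le : V -> V -> Prop) : Prop :=
  (forall x, le x x) /\
  (forall x y, le x y -> le y x -> x = y) /\
  (forall x y z, le x y -> le y z -> le x z) /\
  (forall x y, le x y \/ le y x).

Definition strict {V : Type} (le : V -> V -> Prop) (x y : V) : Prop := le x y /\ x <> y.

Definition stack_layout {V : Type} (G : graph V) (k : nat)
  (le : V -> V -> Prop) (phi : V -> V -> nat) : Prop :=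
  linear_order le /\
  (forall u x, adj G u x -> (1 <= phi u x <= k)%nat /\ phi u x = phi x u) /\
  (forall u v x y, adj G u x -> adj G v y ->
     strict le u v -> strict le v x -> strict le x y -> phi u x <> phi v y).

Definition stack_number_le {V : Type} (G : graph V) (b : R) : Prop :=
  exists k : nat, INR k <= b /\
    exists (le : V -> V -> Prop) (phi : V -> V -> nat), stack_layout G k le phi.

(* Main.v *)
(* Linear growth gives balanced separators: for a finite set W, take the least radius r of a
   ball containing more than half of W.  About 5c balls of radius r/2 cover this ball, and
   by pigeonhole each can be enlarged, below radius r, to a ball bounded by a sphere of at
   most 2c vertices.  The O(c^2) vertices of these spheres cut W into parts of at most half its size.

   Separating recursively produces bags of at most 3s + 3 vertices, s <= 10 c^2 + 4 c, of an
   implicit tree-decomposition.  As in Ganley and Heath's bound of the stack-number by the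
   treewidth plus one, place the new vertices of each bag before all that lies below it, give
   the vertices of each bag distinct colours, and colour each edge by its left end.

   The finite layouts are glued by taking limits along an ultrafilter on the finite vertex
   sets. *)

Require Import Defs.
From Stdlib Require Import Reals List Lia Lra Wf_nat Classical ClassicalEpsilon.
From mathcomp Require filter.
Import ListNotations.
Open Scope R_scope.

(** * Finite sets as duplicate-free lists *)

Lemma list_restrict (V : Type) (W : list V) (P : V -> Prop) :
  exists l, NoDup l /\ forall x, In x l <-> In x W /\ P x.
Proof.
  induction W as [|w W [l [Hnd Hl]]].
  - exists []; split; [constructor|simpl; tauto].
  - destruct (classic (P w /\ ~ In w l)) as [[Hw Hn]|Hn].
    + exists (w :: l); split; [now constructor|].
      intros x; simpl; rewrite Hl; intuition congruence.
    + exists l; split; [assumption|].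
      intros x; simpl; rewrite Hl.
      split; [tauto|].
      intros [[<-|Hx] HP]; [|tauto].
      apply Hl, NNPP; tauto.
Qed.

(** Without a maximiser, every value of [f] on [Q] could be exceeded, so [f] would pass every
    natural number and hence [b]. *)
Lemma bounded_maximal (T : Type) (Q : T -> Prop) (f : T -> nat) (b : R) (t : T) :
  Q t -> (forall s, Q s -> INR (f s) <= b) ->
  exists s, Q s /\ forall s', Q s' -> (f s' <= f s)%nat.
Proof.
  intros Ht Hb.
  apply NNPP; intros Hno.
  assert (Hgrow : forall n, exists s, Q s /\ (n <= f s)%nat).
  { induction n as [|n [s [Hs Hn]]]; [exists t; split; [assumption|lia]|].
    apply NNPP; intros Hstop.
    apply Hno; exists s; split; [assumption|]; intros s' Hs'.
    apply NNPP; intros Hlt; apply Hstop; exists s'; split; [assumption|lia]. }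
  destruct (INR_unbounded b) as [n Hn].
  destruct (Hgrow n) as [s [Hs Hle]].
  apply le_INR in Hle; specialize (Hb s Hs); lra.
Qed.

(** A longest duplicate-free list inside [P] must exhaust [P], since a missing element could be
    prepended. *)
Lemma bounded_finite (V : Type) (P : V -> Prop) (b : R) :
  (forall l, NoDup l -> (forall x, In x l -> P x) -> INR (length l) <= b) ->
  exists l, NoDup l /\ (forall x, In x l <-> P x) /\ INR (length l) <= b.
Proof.
  intros Hb.
  destruct (bounded_maximal (list V) (fun l => NoDup l /\ forall x, In x l -> P x)
              (@length V) b []) as [l [[Hnd Hl] Hmax]].
  - split; [constructor|simpl; tauto].
  - intros s [H1 H2]; auto.
  - exists l; split; [assumption|split; [|auto]].
    intros x; split; [auto|intros Hx].
    apply NNPP; intros Hn.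
    assert (H : (length (x :: l) <= length l)%nat); [|simpl in H; lia].
    apply Hmax; split; [now constructor|].
    intros y [<-|Hy]; auto.
Qed.

Lemma nat_part (x : R) : 0 <= x -> exists n, INR n <= x < INR n + 1.
Proof.
  intros Hx; destruct (INR_unbounded x) as [N HN].
  induction N as [|N IH]; [simpl in HN; lra|].
  destruct (Rlt_le_dec x (INR N)) as [H|H]; [auto|].
  exists N; rewrite S_INR in HN; lra.
Qed.

(** * Balls and spheres *)

Definition ball {V : Type} (G : graph V) (r : nat) (v u : V) : Prop :=
  walk_le (adj G) r v u.

Lemma walk_le_mono (V : Type) (E : V -> V -> Prop) (m n : nat) (u v : V) :
  (m <= n)%nat -> walk_le E m u v -> walk_le E n u v.
Proof.
  intros Hmn H; revert n Hmn; induction H as [|m u v w Huv _ IH]; intros k Hk.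
  - constructor.
  - destruct k as [|k]; [lia|]. apply walk_step with v; [assumption|apply IH; lia].
Qed.

Lemma walk_le_trans (V : Type) (E : V -> V -> Prop) (m n : nat) (u v w : V) :
  walk_le E m u v -> walk_le E n v w -> walk_le E (m + n) u w.
Proof.
  intros H; revert w; induction H as [m v|m u v' v Huv _ IH]; intros w Hw.
  - now apply walk_le_mono with n; [lia|].
  - simpl; apply walk_step with v'; auto.
Qed.

Lemma ball_step (V : Type) (G : graph V) (r : nat) (v u w : V) :
  ball G r v u -> adj G u w -> ball G (S r) v w.
Proof.
  intros H Huw; unfold ball; replace (S r) with (r + 1)%nat by lia.
  apply walk_le_trans with u; [assumption|].
  apply walk_step with w; [assumption|constructor].
Qed.

Lemma ball_sym (V : Type) (G : graph V) (r : nat) (v u : V) :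
  ball G r v u -> ball G r u v.
Proof.
  induction 1 as [|r u v w Huv _ IH]; [constructor|].
  apply ball_step with v; [assumption|now apply adj_sym].
Qed.

Definition linear_growth {V : Type} (G : graph V) (c : R) : Prop :=
  forall r, (1 <= r)%nat -> forall v l,
    NoDup l -> (forall x, In x l -> ball G r v x) -> INR (length l) <= c * INR r.

(** The subgraph induced by a ball of radius [r] has radius at most [r] itself, since short walks
    from the centre never leave the ball. *)
Lemma growth_le_ball (V : Type) (G : graph V) (r : nat) (b : R) (v : V) (l : list V) :
  growth_le G r b -> NoDup l -> (forall x, In x l -> ball G r v x) -> INR (length l) <= b.
Proof.
  intros Hg Hnd Hl.
  apply (Hg (ball G r v) (fun x y => adj G x y /\ ball G r v x /\ ball G r v y)); auto.
  - split; [tauto|].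
    intros x y [H1 [H2 H3]]; split; [now apply adj_sym|auto].
  - exists v; split; [constructor|].
    intros u Hu.
    (* Generalised to walks starting at distance at most [k] from [v]: with [k + n <= r] every
       vertex on the way stays in the ball. *)
    assert (Hgen : forall n a b', walk_le (adj G) n a b' -> forall k, (k + n <= r)%nat ->
      ball G k v a ->
      walk_le (fun x y => adj G x y /\ ball G r v x /\ ball G r v y) n a b').
    { induction 1 as [|n x y z Hxy Hyz IH]; intros k Hk Hx; [constructor|].
      assert (Hy : ball G (S k) v y) by now apply ball_step with x.
      apply walk_step with y.
      - split; [assumption|split].
        + now apply walk_le_mono with k; [lia|].
        + now apply walk_le_mono with (S k); [lia|].
      - apply IH with (S k); [lia|assumption]. }
    apply Hgen with 0%nat; [assumption|lia|constructor].
Qed.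

(** Each sphere around [y] up to radius [t] is nonempty: otherwise a smaller ball would be closed
    under adjacency and contain [z]. One vertex from each sphere gives the list. *)
Lemma ball_lower_bound (V : Type) (G : graph V) (t n : nat) (y z : V) :
  ball G n y z -> ~ ball G t y z ->
  exists l, NoDup l /\ length l = S t /\ forall x, In x l -> ball G t y x.
Proof.
  intros Hz; induction t as [|t IH]; intros Hn.
  - exists [y]; split; [constructor; [auto|constructor]|split; [reflexivity|]].
    intros x [<-|[]]; constructor.
  - assert (Hn' : ~ ball G t y z).
    { intros H; apply Hn; now apply walk_le_mono with t; [lia|]. }
    destruct (IH Hn') as [l [Hnd [Hlen Hl]]].
    assert (Hu : exists u, ball G (S t) y u /\ ~ ball G t y u).
    { apply NNPP; intros Hno.
      assert (Hcl : forall m a b, walk_le (adj G) m a b -> ball G t y a -> ball G t y b).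
      { induction 1 as [|m a b w Hab _ IHw]; [auto|]; intros Ha; apply IHw.
        apply NNPP; intros Hb; apply Hno; exists b; split; [|assumption].
        now apply ball_step with a. }
      apply Hn', (Hcl n y z Hz); constructor. }
    destruct Hu as [u [Hu1 Hu2]].
    exists (u :: l); split; [|split].
    + constructor; [|assumption]; intros Hin; auto.
    + simpl; congruence.
    + intros x [<-|Hx]; [assumption|].
      apply walk_le_mono with t; [lia|now apply Hl].
Qed.

(** The 2q spheres just outside the radii 2q, ..., 4q - 1 are disjoint and lie in a ball of at most
    4cq vertices, so one of them has at most 2c. *)
Lemma small_sphere (V : Type) (G : graph V) (c : R) (q : nat) (v : V) :
  linear_growth G c -> (1 <= q)%nat ->
  exists r l, (2 * q <= r < 4 * q)%nat /\ INR (length l) <= 2 * c /\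
    forall x, ball G (S r) v x -> ~ ball G r v x -> In x l.
Proof.
  intros Hg Hq.
  apply NNPP; intros Hno.
  (* If all spheres are large, the first [i] of them hold more than 2ci vertices. Strictness fails
     at [i = 0], hence the disjunction. *)
  assert (Hbig : forall i, (i <= 2 * q)%nat -> exists l, NoDup l /\
      (forall x, In x l -> ball G (2 * q + i) v x) /\ 2 * c * INR i <= INR (length l) /\
      (i = 0%nat \/ 2 * c * INR i < INR (length l))).
  { induction i as [|i IH]; intros Hi.
    - exists []; split; [constructor|split; [simpl; tauto|simpl; split; [lra|auto]]].
    - destruct IH as [l [Hnd [Hl [Hlen _]]]]; [lia|].
      assert (Hs : exists s, NoDup s /\ (forall x, In x s -> ball G (2 * q + S i) v x /\
                ~ ball G (2 * q + i) v x) /\ 2 * c < INR (length s)).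
      { apply NNPP; intros Hns; apply Hno.
        destruct (bounded_finite V (fun x => ball G (2 * q + S i) v x /\
                ~ ball G (2 * q + i) v x) (2 * c)) as [s [_ [Hs Hb]]].
        - intros s Hs1 Hs2; apply Rnot_lt_le; intros Hlt; apply Hns; eauto.
        - exists (2 * q + i)%nat, s; split; [lia|split; [assumption|]].
          intros x Hx1 Hx2; apply Hs.
          replace (2 * q + S i)%nat with (S (2 * q + i)) by lia; auto. }
      destruct Hs as [s [Hs1 [Hs2 Hs3]]].
      exists (s ++ l); split; [|split].
      + apply NoDup_app; [assumption..|].
        intros x Hx1 Hx2; apply (Hs2 x Hx1); auto.
      + intros x Hx; apply in_app_or in Hx; destruct Hx as [Hx|Hx]; [now apply Hs2|].
        apply walk_le_mono with (2 * q + i)%nat; [lia|now apply Hl].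
      + rewrite length_app, plus_INR, S_INR; lra. }
  destruct (Hbig (2 * q)%nat) as [l [Hnd [Hl [_ [H|H]]]]]; [lia|lia|].
  specialize (Hg (2 * q + 2 * q)%nat ltac:(lia) v l Hnd Hl).
  rewrite plus_INR in Hg; rewrite mult_INR in *; simpl in *; lra.
Qed.

(** * Balanced separators *)

Definition at_most_half {V : Type} (W : list V) (P : V -> Prop) : Prop :=
  forall l, NoDup l -> incl l W -> (forall x, In x l -> P x) ->
    (2 * length l <= length W)%nat.

Lemma at_most_half_mono (V : Type) (W : list V) (P Q : V -> Prop) :
  (forall x, P x -> Q x) -> at_most_half W Q -> at_most_half W P.
Proof. intros H HQ l H1 H2 H3; apply HQ; auto. Qed.

Lemma at_most_half_compl (V : Type) (W : list V) (P : V -> Prop) :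
  ~ at_most_half W P -> at_most_half W (fun x => ~ P x).
Proof.
  intros HP l Hnd Hin Hl; apply NNPP; intros Hlt; apply HP.
  intros l' Hnd' Hin' Hl'.
  assert (H : (length (l ++ l') <= length W)%nat).
  { apply NoDup_incl_length; [|now apply incl_app].
    apply NoDup_app; [assumption..|].
    intros x H1 H2; exact (Hl x H1 (Hl' x H2)). }
  rewrite length_app in H; lia.
Qed.

Definition closed_off {V : Type} (G : graph V) (X : list V) (A : V -> Prop) : Prop :=
  forall u v, A u -> adj G u v -> A v \/ In v X.

(** The regions in [As] may overlap one another and meet [X]. The last clause concerns the remainder
    outside all of them. *)
Definition balanced_separation {V : Type} (G : graph V) (W X : list V)
  (As : list (V -> Prop)) : Prop :=
  (forall A, In A As -> closed_off G X A /\ at_most_half W (fun x => A x /\ ~ In x X)) /\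
  at_most_half W (fun x => (forall A, In A As -> ~ A x) /\ ~ In x X).

Definition pairwise_disjoint_balls {V : Type} (G : graph V) (t : nat) (ys : list V) : Prop :=
  ForallOrdPairs (fun y y' => forall x, ball G t y x -> ~ ball G t y' x) ys.

(** Lists from disjoint balls concatenate without repetition. [P] records a larger ball in which the
    result is then counted. *)
Lemma disjoint_balls_count (V : Type) (G : graph V) (t : nat) (P : V -> Prop) (ys : list V) :
  pairwise_disjoint_balls G t ys ->
  (forall y, In y ys -> exists l, NoDup l /\ length l = S t /\
     forall x, In x l -> ball G t y x /\ P x) ->
  exists l, NoDup l /\ length l = (length ys * S t)%nat /\
    forall x, In x l -> P x /\ exists y, In y ys /\ ball G t y x.
Proof.
  intros Hd; induction Hd as [|y ys Hy _ IH]; intros Hl.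
  - exists []; split; [constructor|split; [reflexivity|simpl; tauto]].
  - destruct IH as [l [Hnd [Hlen Hin]]]; [intros; apply Hl; now right|].
    destruct (Hl y) as [l' [Hnd' [Hlen' Hin']]]; [now left|].
    exists (l' ++ l); split; [|split].
    + apply NoDup_app; [assumption..|].
      intros x H1 H2; destruct (Hin x H2) as [_ [y' [Hy' Hx]]].
      rewrite Forall_forall in Hy; apply (Hy y' Hy' x); [now apply Hin'|assumption].
    + rewrite length_app; simpl; lia.
    + intros x Hx; apply in_app_or in Hx; destruct Hx as [Hx|Hx].
      * split; [now apply Hin'|exists y; split; [now left|now apply Hin']].
      * destruct (Hin x Hx) as [HP [y' [Hy' Hx']]].
        split; [assumption|exists y'; split; [now right|assumption]].
Qed.

(** Each centre gets the ball of the radius chosen by [small_sphere], and [X] collects the bounding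
    spheres. Radius at least 2q preserves a cover by balls of radius 2q; radius below 4q keeps the
    regions small. *)
Lemma regions_around (V : Type) (G : graph V) (c : R) (q : nat) (ys : list V) :
  linear_growth G c -> (1 <= q)%nat ->
  exists X (As : list (V -> Prop)), INR (length X) <= 2 * c * INR (length ys) /\
    (forall A, In A As -> closed_off G X A /\ exists y, forall x, A x -> ball G (4 * q) y x) /\
    (forall y, In y ys -> exists A, In A As /\ forall x, ball G (2 * q) y x -> A x).
Proof.
  intros Hg Hq; induction ys as [|y ys [X [As [HX [HA Hys]]]]].
  - exists [], []; simpl; split; [lra|split; tauto].
  - destruct (small_sphere V G c q y Hg Hq) as [r [l [Hr [Hlen Hl]]]].
    exists (l ++ X), (ball G r y :: As); split; [|split].
    + rewrite length_app, plus_INR; simpl length; rewrite S_INR; lra.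
    + intros A [<-|HinA].
      * split.
        -- intros u v Hu Huv.
           destruct (classic (ball G r y v)) as [Hv|Hv]; [now left|right].
           apply in_or_app; left; apply Hl; [now apply ball_step with u|assumption].
        -- exists y; intros x; apply walk_le_mono; lia.
      * destruct (HA A HinA) as [Hc Hb]; split; [|assumption].
        intros u v Hu Huv; destruct (Hc u v Hu Huv); [now left|].
        right; apply in_or_app; now right.
    + intros y' [<-|Hy'].
      * exists (ball G r y); split; [now left|].
        intros x; apply walk_le_mono; lia.
      * destruct (Hys y' Hy') as [A [H1 H2]]; exists A; split; [now right|assumption].
Qed.

(** Finitely many vertices of a component lie in one ball, so no component holds more than half of
    [W]. The components of the vertices of [W] then serve as regions, with nothing to remove. *)
Lemma separation_by_components (V : Type) (G : graph V) (W : list V) :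
  (forall r v, at_most_half W (ball G r v)) ->
  exists As, balanced_separation G W [] As.
Proof.
  intros Hhalf.
  exists (map (fun w x => exists r, ball G r w x) W); split.
  - intros A HA; apply in_map_iff in HA; destruct HA as [w [<- Hw]]; split.
    + intros u v [r Hu] Huv; left; exists (S r); now apply ball_step with u.
    + intros l Hnd Hin Hl.
      assert (Hr : exists r, forall x, In x l -> ball G r w x).
      { clear Hnd Hin; induction l as [|x l IH]; [exists 0%nat; simpl; tauto|].
        destruct IH as [r Hr]; [intros; apply Hl; now right|].
        destruct (Hl x) as [[s Hs] _]; [now left|].
        exists (Nat.max r s); intros z [<-|Hz].
        - apply walk_le_mono with s; [lia|assumption].
        - apply walk_le_mono with r; [lia|now apply Hr]. }
      destruct Hr as [r Hr]; now apply (Hhalf r w).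
  - intros [|x l] Hnd Hin Hl; [simpl; lia|].
    destruct (Hl x) as [H _]; [now left|].
    exfalso; apply (H (fun z => exists r, ball G r x z)); [|exists 0%nat; constructor].
    apply (in_map (fun w z => exists r, ball G r w z) W x), Hin; now left.
Qed.

(** Take a maximal family of disjoint balls of radius [q] centred in the big ball. Each has at least
    q + 1 vertices, and all lie in a ball of at most 5c(q + 1) vertices. *)
Lemma ball_cover (V : Type) (G : graph V) (c : R) (q r : nat) (v : V) :
  linear_growth G c -> 0 <= c -> (r + q <= 5 * (q + 1))%nat -> (1 <= r)%nat ->
  (forall y, exists z, ball G r v z /\ ~ ball G q y z) ->
  exists ys, INR (length ys) <= 5 * c /\
    forall x, ball G r v x -> exists y, In y ys /\ ball G (2 * q) y x.
Proof.
  intros Hg Hc Hq Hr Hfar.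
  set (Q := fun ys => pairwise_disjoint_balls G q ys /\ forall y, In y ys -> ball G r v y).
  assert (Hbound : forall ys, Q ys -> INR (length ys) <= 5 * c).
  { intros ys [Hd Hys].
    destruct (disjoint_balls_count V G q (ball G (r + q) v) ys Hd) as [l [Hnd [Hlen Hl]]].
    - intros y Hy; destruct (Hfar y) as [z [Hz1 Hz2]].
      destruct (ball_lower_bound V G q (r + r) y z) as [l [H1 [H2 H3]]].
      + apply walk_le_trans with v; [apply ball_sym; now apply Hys|assumption].
      + assumption.
      + exists l; split; [assumption|split; [assumption|]].
        intros x Hx; split; [auto|].
        apply walk_le_trans with y; [now apply Hys|now apply H3].
    - assert (H : INR (length l) <= c * INR (r + q)).
      { apply Hg with v; [lia|assumption|intros x Hx; now apply Hl]. }
      rewrite Hlen, mult_INR, S_INR in H.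
      apply le_INR in Hq; rewrite mult_INR, (plus_INR q) in Hq; simpl (INR 1) in Hq.
      replace (INR 5) with 5 in Hq by (simpl; lra).
      assert (0 <= INR q) by apply pos_INR.
      apply Rmult_le_reg_r with (INR q + 1); [lra|].
      apply Rle_trans with (c * INR (r + q)); [assumption|].
      apply Rle_trans with (c * (5 * (INR q + 1))); [now apply Rmult_le_compat_l|lra]. }
  destruct (bounded_maximal (list V) Q (@length V) (5 * c) []) as [ys [HQ Hmax]].
  - split; [constructor|simpl; tauto].
  - assumption.
  - exists ys; split; [auto|].
    (* An uncovered [x] could join the family: a vertex common to its ball and that of [y] would put
       [x] within 2q of [y]. *)
    intros x Hx; apply NNPP; intros Hno.
    assert (H : (length (x :: ys) <= length ys)%nat); [|simpl in H; lia].
    destruct HQ as [Hd Hys].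
    apply Hmax; split.
    + constructor; [|assumption].
      apply Forall_forall; intros y Hy z Hz1 Hz2; apply Hno; exists y; split; [assumption|].
      replace (2 * q)%nat with (q + q)%nat by lia.
      apply walk_le_trans with z; [assumption|now apply ball_sym].
    + intros y [<-|Hy]; auto.
Qed.

Lemma least_nat (P : nat -> Prop) (n : nat) :
  P n -> exists m, P m /\ forall k, (k < m)%nat -> ~ P k.
Proof.
  intros Hn; apply NNPP; intros Hno.
  revert Hn; induction n as [n IH] using lt_wf_ind; intros Hn.
  apply Hno; exists n; split; [assumption|]; intros k Hk HP; now apply (IH k).
Qed.

(** The term 10c^2 counts at most 5c spheres of at most 2c vertices each; 4c pays for a whole ball
    when the critical radius is at most 4. *)
Lemma balanced_separation_exists (V : Type) (G : graph V) (c : R) (W : list V) :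
  1 <= c -> linear_growth G c ->
  exists X As, INR (length X) <= 10 * c ^ 2 + 4 * c /\ balanced_separation G W X As.
Proof.
  intros Hc Hg.
  destruct (classic (forall r v, at_most_half W (ball G r v))) as [Hhalf|Hbig].
  { destruct (separation_by_components V G W Hhalf) as [As HAs].
    exists [], As; split; [simpl; nra|assumption]. }
  assert (Hbig' : exists r, exists v, ~ at_most_half W (ball G r v)).
  { apply NNPP; intros Hno; apply Hbig; intros r v; apply NNPP; intros H; apply Hno; eauto. }
  destruct Hbig' as [n Hn].
  destruct (least_nat (fun r => exists v, ~ at_most_half W (ball G r v)) n Hn) as [r [[v Hv] Hmin]]; clear n Hn Hbig.
  assert (Hsmall : forall k y, (k < r)%nat -> at_most_half W (ball G k y)).
  { intros k y Hk; apply NNPP; intros H; apply (Hmin k Hk); now exists y. }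
  apply at_most_half_compl in Hv as Hout.
  destruct (Nat.le_gt_cases r 4) as [Hr|Hr].
  - destruct (bounded_finite V (ball G r v) (c * INR 4)) as [X [_ [HX Hlen]]].
    { intros l Hnd Hl; apply (Hg 4%nat ltac:(lia) v l Hnd).
      intros x Hx; apply walk_le_mono with r; [lia|now apply Hl]. }
    exists X, []; split; [simpl in Hlen; nra|split; [simpl; tauto|]].
    apply at_most_half_mono with (2 := Hout); intros x [_ Hx] H; now apply Hx, HX.
  (* The largest [q] with 4q < r: regions inside balls of radius 4q hold at most half of [W] by
     minimality of [r], and r + q <= 5(q + 1). *)
  - set (q := ((r - 1) / 4)%nat).
    assert (Hq : (4 * q + 1 <= r <= 4 * q + 4)%nat).
    { assert (H := Nat.div_mod_eq (r - 1) 4).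
      assert (H' := Nat.mod_upper_bound (r - 1) 4); unfold q; lia. }
    destruct (ball_cover V G c q r v Hg) as [ys [Hlen Hys]]; [lra|lia|lia| |].
    (* A ball of radius [q] containing the critical ball would also hold more than half of [W],
       although q < r. *)
    { intros y; apply NNPP; intros Hno; apply Hv.
      apply at_most_half_mono with (ball G q y); [|apply Hsmall; lia].
      intros x Hx; apply NNPP; intros H; apply Hno; now exists x. }
    destruct (regions_around V G c q ys Hg) as [X [As [HX [HA Hcov]]]]; [lia|].
    exists X, As; split; [nra|split].
    + intros A HinA; destruct (HA A HinA) as [Hcl [y Hy]]; split; [assumption|].
      apply at_most_half_mono with (ball G (4 * q) y); [|apply Hsmall; lia].
      intros x [Hx _]; auto.
    + apply at_most_half_mono with (2 := Hout); intros x [Hx _] Hb.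
      destruct (Hys x Hb) as [y [Hy Hxy]]; destruct (Hcov y Hy) as [A [HinA HyA]].
      exact (Hx A HinA (HyA x Hxy)).
Qed.

(** * Finite layouts *)

(* The edges are coloured by their left ends.  The vertices of W are to come before all of
   U, with colours given in advance; the layout orders and colours U without a conflict
   between any edges whose right ends lie in U. *)
Definition extends_layout {V : Type} (G : graph V) (k : nat) (W U : list V) : Prop :=
  forall col0 : V -> nat,
    (forall w, In w W -> (1 <= col0 w <= k)%nat) ->
    (forall w w', In w W -> In w' W -> col0 w = col0 w' -> w = w') ->
    exists pos col : V -> nat,
      (forall x, In x U -> (1 <= col x <= k)%nat) /\
      (forall x y, In x U -> In y U -> pos x = pos y -> x = y) /\
      (forall v x y, In v U -> In x U -> In y U -> (pos v < pos x < pos y)%nat -> adj G v y ->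
         (forall w, In w W -> adj G w x -> col0 w <> col v) /\
         (forall u, In u U -> (pos u < pos v)%nat -> adj G u x -> col u <> col v)).

Lemma extends_layout_nil (V : Type) (G : graph V) (k : nat) (W : list V) :
  extends_layout G k W [].
Proof. intros col0 _ _; exists (fun _ => 0%nat), (fun _ => 0%nat); simpl; tauto. Qed.

(** A vertex of [W] constrains the layout only through its edges into [U]; without such edges it may
    be forgotten and its colour reused. *)
Lemma extends_layout_restrict (V : Type) (G : graph V) (k : nat) (W W' U U' : list V) :
  incl U U' -> incl W' W ->
  (forall w x, In w W -> In x U -> adj G w x -> In w W') ->
  extends_layout G k W' U' -> extends_layout G k W U.
Proof.
  intros HU HW Hadj HL col0 Hr Hi.
  destruct (HL col0) as [pos [col [H1 [H2 H3]]]]; [auto|auto|].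
  exists pos, col; split; [auto|split; [auto|]].
  intros v x y Hv Hx Hy Hlt Hvy.
  destruct (H3 v x y) as [K1 K2]; auto.
  split; [|auto].
  intros w Hw Hwx; apply K1; [now apply Hadj with x|assumption].
Qed.

Lemma fresh_color (V : Type) (W : list V) (k : nat) (col : V -> nat) :
  (length W < k)%nat -> exists i, (1 <= i <= k)%nat /\ forall w, In w W -> col w <> i.
Proof.
  intros Hlt; apply NNPP; intros Hno.
  assert (H : (length (seq 1 k) <= length (map col W))%nat).
  { apply NoDup_incl_length; [apply seq_NoDup|].
    intros i Hi; apply in_seq in Hi; apply NNPP; intros Hn; apply Hno.
    exists i; split; [lia|]; intros w Hw He; apply Hn; rewrite <- He; now apply in_map. }
  rewrite length_seq, length_map in H; lia.
Qed.

Definition update {V : Type} (f : V -> nat) (a : V) (i : nat) (x : V) : nat :=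
  if excluded_middle_informative (x = a) then i else f x.

Lemma update_eq (V : Type) (f : V -> nat) (a : V) (i : nat) : update f a i a = i.
Proof. unfold update; destruct excluded_middle_informative; tauto. Qed.

Lemma update_neq (V : Type) (f : V -> nat) (a : V) (i : nat) (x : V) :
  x <> a -> update f a i x = f x.
Proof. unfold update; destruct excluded_middle_informative; tauto. Qed.

Lemma extends_layout_intro (V : Type) (G : graph V) (k : nat) (a : V) (W U U' : list V) :
  (length W < k)%nat -> (forall x, In x U -> ~ In x W) ->
  (forall x, In x U -> x = a \/ In x U') ->
  extends_layout G k (a :: W) U' -> extends_layout G k W U.
Proof.
  intros Hk Hd HU HL.
  destruct (classic (In a W)) as [Ha|Ha].
  { apply extends_layout_restrict with (a :: W) U'; auto.
    - intros x Hx; destruct (HU x Hx) as [->|H]; [|assumption]; now destruct (Hd a Hx).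
    - intros w [<-|Hw]; assumption.
    - intros w x Hw _ _; now right. }
  intros col0 Hr Hi.
  destruct (fresh_color V W k col0 Hk) as [i [Hik Hi0]].
  assert (HW : forall w, In w W -> update col0 a i w = col0 w).
  { intros w Hw; apply update_neq; congruence. }
  destruct (HL (update col0 a i)) as [pos [col [H1 [H2 H3]]]].
  { intros w [<-|Hw]; [now rewrite update_eq|rewrite HW; auto]. }
  { intros w w' [<-|Hw] [<-|Hw']; rewrite ?update_eq, ?HW by assumption; auto.
    - intros E; now destruct (Hi0 w' Hw').
    - intros E; now destruct (Hi0 w Hw). }
  (* The shift by one frees position 0 for [a], so [a] can only be the left end of either crossing
     edge. *)
  exists (update (fun x => S (pos x)) a 0), (update col a i).
  split; [|split].
  - intros x Hx; destruct (classic (x = a)) as [->|Hxa]; [now rewrite update_eq|].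
    rewrite update_neq by assumption; destruct (HU x Hx); [tauto|auto].
  - intros x y Hx Hy.
    destruct (classic (x = a)) as [->|Hxa], (classic (y = a)) as [->|Hya];
      rewrite ?update_eq, ?update_neq by assumption; try congruence; try discriminate.
    destruct (HU x Hx), (HU y Hy); try tauto; intros E; apply H2; auto.
  - intros v x y Hv Hx Hy Hlt Hvy.
    assert (Hpos : forall z u, (update (fun x => S (pos x)) a 0 z <
               update (fun x => S (pos x)) a 0 u)%nat -> u <> a).
    { intros z u Hzu ->; rewrite update_eq in Hzu; lia. }
    assert (Hxa : x <> a) by now apply (Hpos v).
    assert (Hya : y <> a) by now apply (Hpos x).
    destruct (classic (v = a)) as [->|Hva].
    + rewrite update_eq; split; [auto|].
      intros u _ Hu; now destruct (Hpos u a Hu).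
    + rewrite (update_neq V col) by assumption.
      rewrite !update_neq in Hlt by assumption.
      destruct (HU v Hv), (HU x Hx), (HU y Hy); try tauto.
      destruct (H3 v x y) as [K1 K2]; auto; [lia|].
      split.
      * intros w Hw Hwx; rewrite <- HW by assumption; apply K1; [now right|assumption].
      * intros u Hu Huv Hux; destruct (classic (u = a)) as [->|Hua].
        -- rewrite update_eq, <- (update_eq V col0 a i); apply K1; [now left|assumption].
        -- rewrite !update_neq in * by assumption.
           destruct (HU u Hu); [tauto|]; apply K2; auto; lia.
Qed.

Lemma extends_layout_intros (V : Type) (G : graph V) (k : nat) (X W U U' : list V) :
  (length X + length W <= k)%nat -> (forall x, In x U -> ~ In x W) ->
  (forall x, In x U -> In x X \/ In x U') ->
  extends_layout G k (X ++ W) U' -> extends_layout G k W U.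
Proof.
  revert W U; induction X as [|a X IH]; intros W U Hk Hd HU HL.
  - apply extends_layout_restrict with W U'; auto using incl_refl.
    intros x Hx; now destruct (HU x Hx) as [[]|H].
  (* Once placed, [a] counts as part of [W], which has to stay disjoint from the list still to be
     laid out. *)
  - destruct (list_restrict V U (fun x => x <> a)) as [U1 [_ HU1]].
    simpl in Hk.
    apply extends_layout_intro with a U1; [lia|assumption| |].
    + intros x Hx; destruct (classic (x = a)); [now left|right; now apply HU1].
    + apply IH; [simpl; lia| | |].
      * intros x Hx; apply HU1 in Hx; destruct Hx as [Hx Hxa].
        intros [<-|Hw]; [tauto|now apply (Hd x)].
      * intros x Hx; apply HU1 in Hx; destruct Hx as [Hx Hxa].
        destruct (HU x Hx) as [[<-|H]|H]; tauto.
      * apply extends_layout_restrict with ((a :: X) ++ W) U'; auto using incl_refl.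
        -- intros w Hw; simpl in *; rewrite in_app_iff in *; simpl; tauto.
        -- intros w x Hw _ _; simpl in *; rewrite in_app_iff in *; simpl in *; tauto.
Qed.

Lemma list_max_lt (V : Type) (f : V -> nat) (U : list V) :
  exists M, forall x, In x U -> (f x < M)%nat.
Proof.
  induction U as [|a U [M HM]]; [exists 0%nat; simpl; tauto|].
  exists (Nat.max (S (f a)) M); intros x [<-|Hx]; [lia|].
  specialize (HM x Hx); lia.
Qed.

(** All of [U1] is placed before the rest. With no edges between the two sides, crossing edges
    within [U] lie on one side, and both sides respect the same colours on [W]. *)
Lemma extends_layout_split (V : Type) (G : graph V) (k : nat) (W U U1 U2 : list V) :
  (forall x, In x U -> In x U1 \/ In x U2) ->
  (forall x y, In x U1 -> In y U2 -> ~ adj G x y) ->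
  extends_layout G k W U1 -> extends_layout G k W U2 -> extends_layout G k W U.
Proof.
  intros HU Hno HL1 HL2 col0 Hr Hi.
  destruct (HL1 col0 Hr Hi) as [pos1 [col1 [A1 [A2 A3]]]].
  destruct (HL2 col0 Hr Hi) as [pos2 [col2 [B1 [B2 B3]]]].
  destruct (list_max_lt V pos1 U1) as [M HM].
  set (pick := fun (f g : V -> nat) x =>
    if excluded_middle_informative (In x U1) then f x else g x).
  set (pos := pick pos1 (fun x => M + pos2 x)%nat).
  set (col := pick col1 col2).
  assert (P1 : forall f g x, In x U1 -> pick f g x = f x).
  { intros f g x Hx; unfold pick; destruct excluded_middle_informative; tauto. }
  assert (P2 : forall f g x, ~ In x U1 -> pick f g x = g x).
  { intros f g x Hx; unfold pick; destruct excluded_middle_informative; tauto. }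
  assert (Hup : forall x y, ~ In x U1 -> In y U1 -> (pos y < pos x)%nat).
  { intros x y Hx Hy; unfold pos; rewrite P1, P2 by assumption.
    specialize (HM y Hy); lia. }
  assert (HU2 : forall x, In x U -> ~ In x U1 -> In x U2) by (intros x Hx ?; destruct (HU x Hx); tauto).
  exists pos, col; split; [|split].
  - intros x Hx; unfold col; destruct (classic (In x U1)); rewrite ?P1, ?P2 by assumption; auto.
  - intros x y Hx Hy E.
    destruct (classic (In x U1)) as [H|H], (classic (In y U1)) as [H'|H'].
    + unfold pos in E; rewrite !P1 in E by assumption; auto.
    + specialize (Hup y x H' H); lia.
    + specialize (Hup x y H H'); lia.
    + unfold pos in E; rewrite !P2 in E by assumption; apply B2; auto; lia.
  - intros v x y Hv Hx Hy Hlt Hvy.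
    destruct (classic (In v U1)) as [Hv1|Hv1].
    + assert (Hy1 : In y U1).
      { apply NNPP; intros H; now apply (Hno v y); auto. }
      assert (Hx1 : In x U1).
      { apply NNPP; intros H; specialize (Hup x y H Hy1); lia. }
      unfold pos in Hlt; rewrite !P1 in Hlt by assumption.
      destruct (A3 v x y) as [K1 K2]; auto.
      unfold col; rewrite (P1 _ _ v) by assumption; split; [auto|].
      intros u Hu Huv Hux.
      assert (Hu1 : In u U1).
      { apply NNPP; intros H; specialize (Hup u v H Hv1); lia. }
      unfold pos in Huv; rewrite !P1 in * by assumption; auto.
    + assert (Hx1 : ~ In x U1) by (intros H; specialize (Hup v x Hv1 H); lia).
      assert (Hy1 : ~ In y U1) by (intros H; specialize (Hup v y Hv1 H); lia).
      unfold pos in Hlt; rewrite !P2 in Hlt by assumption.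
      destruct (B3 v x y) as [K1 K2]; auto; [lia|].
      unfold col; rewrite (P2 _ _ v) by assumption; split; [auto|].
      intros u Hu Huv Hux.
      assert (Hu1 : ~ In u U1) by (intros H; now apply (Hno u x); auto).
      unfold pos in Huv; rewrite !P2 in * by assumption; apply K2; auto; lia.
Qed.

(** Regions are split off one at a time, so overlaps do no harm: an edge from a region to the
    vertices outside it ends in [X], which [U] avoids. *)
Lemma extends_layout_regions (V : Type) (G : graph V) (k : nat) (W X : list V)
  (As : list (V -> Prop)) (U : list V) :
  (forall x, In x U -> ~ In x X) ->
  (forall A, In A As -> closed_off G X A) ->
  (forall A U', In A As -> incl U' U -> (forall x, In x U' -> A x) -> extends_layout G k W U') ->
  (forall U', incl U' U -> (forall x, In x U' -> forall A, In A As -> ~ A x) ->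
     extends_layout G k W U') ->
  extends_layout G k W U.
Proof.
  revert U; induction As as [|A As IH]; intros U HX Hc Hin Hout.
  - apply Hout; [apply incl_refl|simpl; tauto].
  - destruct (list_restrict V U A) as [U1 [_ HU1]].
    destruct (list_restrict V U (fun x => ~ A x)) as [U2 [_ HU2]].
    assert (Hsub : incl U2 U) by (intros x Hx; now apply HU2).
    apply extends_layout_split with U1 U2.
    + intros x Hx; rewrite HU1, HU2; tauto.
    + intros x y Hx Hy Hxy; apply HU1 in Hx; apply HU2 in Hy.
      destruct (Hc A (or_introl eq_refl) x y) as [H|H]; [tauto|tauto|tauto|].
      now apply (HX y).
    + apply Hin with A; [now left| |]; intros x Hx; now apply HU1.
    + apply IH.
      * auto.
      * intros B HB; apply Hc; now right.
      * intros B U' HB HU'; apply Hin; [now right|now apply incl_tran with U2].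
      * intros U' HU' Hn; apply Hout; [now apply incl_tran with U2|].
        intros x Hx B [<-|HB]; [now apply HU2, HU'|now apply Hn].
Qed.

(** A bag consists of [W], [X] and one vertex [a] of [U]: at most (2s + 2) + s + 1 vertices. Each
    part keeps at most s + 1 vertices of [W] besides [a :: X], so the bound 2s + 2 recurs; placing
    [a] makes [U] shrink. *)
Lemma extends_layout_exists (V : Type) (G : graph V) (s : nat) :
  (forall W, exists X As, (length X <= s)%nat /\ balanced_separation G W X As) ->
  forall W U, (length W <= 2 * s + 2)%nat -> (forall x, In x U -> ~ In x W) ->
  extends_layout G (3 * s + 3) W U.
Proof.
  intros Hsep W U; remember (length U) as n eqn:Hn; assert (Hle : (length U <= n)%nat) by lia.
  clear Hn; revert W U Hle.
  induction n as [|n IH]; intros W [|a U] Hle HW Hd;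
    [apply extends_layout_nil|simpl in Hle; lia|apply extends_layout_nil|].
  destruct (Hsep W) as [X [As [HX [HA Hout]]]].
  destruct (list_restrict V (a :: U) (fun x => ~ In x (a :: X))) as [U' [_ HU']].
  apply extends_layout_intros with (a :: X) U'; [simpl; lia|assumption| |].
  { intros x Hx; rewrite HU'; tauto. }
  (* Common to the regions and the remainder: vertices of [W] outside [P] and [X] have no neighbours
     in [U0] and are dropped before recursing. *)
  assert (Hpart : forall (P : V -> Prop) U0, at_most_half W (fun x => P x /\ ~ In x X) ->
            incl U0 U' -> (forall w x, In x U0 -> adj G w x -> P w \/ In w X) ->
            extends_layout G (3 * s + 3) ((a :: X) ++ W) U0).
  { intros P U0 Hhalf HU0 Hnb.
    destruct (list_restrict V W (fun x => P x /\ ~ In x X)) as [W0 [HndW0 HW0]].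
    (* Removes repetitions, so that the length can be compared with that of [a :: U]. *)
    destruct (list_restrict V U0 (fun _ => True)) as [U1 [HndU1 HU1]].
    assert (HW0' : (2 * length W0 <= length W)%nat).
    { apply Hhalf; [assumption| |]; intros x Hx; now apply HW0. }
    apply extends_layout_restrict with ((a :: X) ++ W0) U1.
    - intros x Hx; now apply HU1.
    - intros w Hw; apply in_app_or in Hw; apply in_or_app.
      destruct Hw as [Hw|Hw]; [now left|right; now apply HW0].
    - intros w x Hw Hx Hwx; apply in_app_or in Hw; apply in_or_app.
      destruct Hw as [Hw|Hw]; [now left|].
      destruct (classic (In w X)) as [H|H]; [left; now right|].
      right; apply HW0; split; [assumption|split; [|assumption]].
      destruct (Hnb w x Hx Hwx); tauto.
    - assert (HU1' : forall x, In x U1 -> In x (a :: U) /\ ~ In x (a :: X)).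
      { intros x Hx; apply HU', HU0; now apply HU1. }
      apply IH.
      + assert (H : (length (a :: U1) <= length (a :: U))%nat); [|simpl in *; lia].
        apply NoDup_incl_length.
        * constructor; [|assumption]; intros H; apply (HU1' a H); now left.
        * intros x [<-|Hx]; [now left|now apply HU1'].
      + rewrite length_app; simpl; lia.
      + intros x Hx Hw; apply in_app_or in Hw; destruct Hw as [Hw|Hw].
        * now apply (HU1' x Hx).
        * apply (Hd x); [now apply HU1'|now apply HW0]. }
  apply extends_layout_regions with X As.
  - intros x Hx H; apply HU' in Hx; apply Hx; now right.
  - intros A HinA; now apply HA.
  - intros A U0 HinA HU0 HAx; destruct (HA A HinA) as [Hcl Hhalf].
    apply (Hpart A); [assumption..|].
    intros w x Hx Hwx; apply (Hcl x w); [now apply HAx|now apply adj_sym].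
  - intros U0 HU0 Hn; apply (Hpart (fun x => forall A, In A As -> ~ A x)); [assumption..|].
    intros w x Hx Hwx; left; intros A HinA HAw.
    destruct (HA A HinA) as [Hcl _]; destruct (Hcl w x HAw Hwx) as [H|H].
    + exact (Hn x Hx A HinA H).
    + apply HU0, HU' in Hx; apply Hx; now right.
Qed.

(** * Compactness *)

(** The collections containing all lists that extend some fixed finite set form a proper filter; any
    ultrafilter above it contains, for each [x], the lists through [x]. *)
Lemma list_ultrafilter (V : Type) :
  exists M : (list V -> Prop) -> Prop,
    (forall P Q : list V -> Prop, M P -> (forall F, P F -> Q F) -> M Q) /\
    (forall P Q : list V -> Prop, M P -> M Q -> M (fun F => P F /\ Q F)) /\
    (forall P, M P \/ M (fun F => ~ P F)) /\
    (forall P, M P -> exists F, P F) /\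
    (forall x, M (fun F => In x F)).
Proof.
  set (B := fun P : list V -> Prop => exists F0, forall F, incl F0 F -> P F).
  assert (HB : filter.ProperFilter B).
  { constructor.
    - intros [F0 H]; exact (H F0 (incl_refl F0)).
    - constructor.
      + exists []; intros F _; exact I.
      + intros P Q [F1 H1] [F2 H2]; exists (F1 ++ F2); intros F HF; split.
        * apply H1; intros x Hx; apply HF, in_or_app; now left.
        * apply H2; intros x Hx; apply HF, in_or_app; now right.
      + intros P Q HPQ [F0 H]; exists F0; intros F HF; apply HPQ, H, HF. }
  destruct (filter.ultraFilterLemma HB) as [M [HM HBM]].
  assert (HMF := @filter.filter_filter _ _ (@filter.ultra_proper _ _ HM)).
  exists M; split; [|split; [|split; [|split]]].
  - intros P Q HP HPQ; exact (@filter.filterS _ _ HMF P Q HPQ HP).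
  - intros P Q HP HQ; exact (@filter.filterI _ _ HMF P Q HP HQ).
  - intros P; exact (filter.in_ultra_setVsetC P HM).
  - intros P HP; apply NNPP; intros Hno.
    apply (@filter.filter_not_empty _ M (@filter.ultra_proper _ _ HM)).
    apply (@filter.filterS _ _ HMF P); [|assumption].
    intros F HF; apply Hno; now exists F.
  - intros x; apply HBM; exists [x]; intros F HF; apply HF; now left.
Qed.

(** Order and colours are those holding in [M]-almost all finite layouts. A violated condition
    involves finitely many vertices, so it would already be violated in one finite layout. *)
Lemma stack_layout_compactness (V : Type) (G : graph V) (k : nat) :
  (forall U, extends_layout G k [] U) -> exists le phi, stack_layout G k le phi.
Proof.
  intros Hfin.
  set (good := fun F (pc : (V -> nat) * (V -> nat)) =>
      (forall x, In x F -> (1 <= snd pc x <= k)%nat) /\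
      (forall x y, In x F -> In y F -> fst pc x = fst pc y -> x = y) /\
      (forall u v x y, In u F -> In v F -> In x F -> In y F ->
         (fst pc u < fst pc v < fst pc x)%nat -> (fst pc x < fst pc y)%nat ->
         adj G u x -> adj G v y -> snd pc u <> snd pc v)).
  assert (Hpc : forall F, exists pc, good F pc).
  { intros F; destruct (Hfin F (fun _ => 0%nat)) as [pos [col [H1 [H2 H3]]]];
      [simpl; tauto|simpl; tauto|].
    exists (pos, col); split; [assumption|split; [assumption|simpl]].
    intros u v x y Hu Hv Hx Hy Huv Hxy Hux Hvy.
    apply (H3 v x y); auto; lia. }
  set (pc := fun F => proj1_sig (constructive_indefinite_description _ (Hpc F))).
  assert (Hgood : forall F, good F (pc F)).
  { intros F; exact (proj2_sig (constructive_indefinite_description _ (Hpc F))). }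
  clearbody pc.
  destruct (list_ultrafilter V) as [M [Mmono [Mand [Mor [Mex Min]]]]].
  set (le := fun x y => M (fun F => (fst (pc F) x <= fst (pc F) y)%nat)).
  assert (Hlim : forall x, exists i, (1 <= i <= k)%nat /\ M (fun F => snd (pc F) x = i)).
  { intros x; apply NNPP; intros Hno.
    (* If no colour is taken almost everywhere, the colours 1, ..., k are excluded in turn, leaving
       none. *)
    assert (H : forall j, (j <= k)%nat -> M (fun F => In x F /\ (j < snd (pc F) x)%nat)).
    { induction j as [|j IH]; intros Hj.
      - apply Mmono with (1 := Min x); intros F HF; split; [assumption|].
        now apply (Hgood F).
      - destruct (Mor (fun F => snd (pc F) x = S j)) as [H|H].
        + destruct Hno; exists (S j); split; [lia|assumption].
        + apply Mmono with (1 := Mand _ _ H (IH ltac:(lia))).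
          intros F [H1 [H2 H3]]; split; [assumption|lia]. }
    destruct (Mex _ (H k (le_n k))) as [F [HF Hk]].
    destruct (Hgood F) as [H1 _]; specialize (H1 x HF); lia. }
  destruct (constructive_indefinite_description _
    (ex_intro (fun psi : V -> nat => forall x, (1 <= psi x <= k)%nat /\
       M (fun F => snd (pc F) x = psi x))
      (fun x => proj1_sig (constructive_indefinite_description _ (Hlim x)))
      (fun x => proj2_sig (constructive_indefinite_description _ (Hlim x)))))
    as [psi Hpsi].
  assert (Hanti : forall x y, le x y -> le y x -> x = y).
  { intros x y H1 H2.
    (* Positions are injective only on [F], so [F] must also contain [x] and [y]. *)
    destruct (Mex _ (Mand _ _ (Mand _ _ H1 H2) (Mand _ _ (Min x) (Min y))))
      as [F [[K1 K2] [Hx Hy]]].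
    apply (Hgood F); auto; lia. }
  assert (Hstrict : forall x y, strict le x y ->
            M (fun F => In x F /\ In y F /\ (fst (pc F) x < fst (pc F) y)%nat)).
  { intros x y [H Hne].
    apply Mmono with (1 := Mand _ _ H (Mand _ _ (Min x) (Min y))).
    intros F [K [Hx Hy]]; split; [assumption|split; [assumption|]].
    destruct (proj1 (Nat.lt_eq_cases _ _) K) as [Hlt|E]; [assumption|].
    now destruct Hne; apply (Hgood F). }
  exists le, (fun u x => if excluded_middle_informative (le u x) then psi u else psi x).
  split; [|split].
  - split; [|split; [assumption|split]].
    + intros x; apply Mmono with (1 := Min x); auto.
    + intros x y z H1 H2; apply Mmono with (1 := Mand _ _ H1 H2); intros F [K1 K2]; lia.
    + intros x y; destruct (Mor (fun F => (fst (pc F) x <= fst (pc F) y)%nat)) as [H|H];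
        [now left|right].
      apply Mmono with (1 := H); intros F K; lia.
  - intros u x Hux; split; [destruct excluded_middle_informative; apply Hpsi|].
    destruct excluded_middle_informative as [H1|H1],
      excluded_middle_informative as [H2|H2]; try reflexivity.
    + now rewrite (Hanti u x H1 H2).
    + destruct (Mor (fun F => (fst (pc F) u <= fst (pc F) x)%nat)) as [H|H]; [tauto|].
      destruct H2; apply Mmono with (1 := H); intros F K; lia.
  - intros u v x y Hux Hvy Huv Hvx Hxy.
    assert (Hle : forall a b c, strict le a b -> strict le b c -> le a c).
    { intros a b c [H1 _] [H2 _]; apply Mmono with (1 := Mand _ _ H1 H2).
      intros F [K1 K2]; lia. }
    destruct excluded_middle_informative as [_|H]; [|now destruct H; apply Hle with v].
    destruct excluded_middle_informative as [_|H]; [|now destruct H; apply Hle with x].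
    (* One [F] contains all four vertices and shows their limit order and the limit colours of [u]
       and [v]; its layout forbids this crossing. *)
    intros E.
    destruct (Mex _ (Mand _ _ (Mand _ _ (Hstrict u v Huv) (Hstrict v x Hvx))
        (Mand _ _ (Hstrict x y Hxy) (Mand _ _ (proj2 (Hpsi u)) (proj2 (Hpsi v))))))
      as [F [[[Fu [Fv L1]] [_ [Fx L2]]] [[_ [Fy L3]] [Eu Ev]]]].
    apply (proj2 (proj2 (Hgood F)) u v x y); auto; congruence.
Qed.

(** * The bound on the stack-number *)

Theorem theorem2 (c : R) (V : Type) (G : graph V) :
  1 <= c ->
  (forall r : nat, (1 <= r)%nat -> growth_le G r (c * INR r)) ->
  stack_number_le G (49 * c ^ 2 + 30 * c + 1).
Proof.
  intros Hc Hgrowth.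
  assert (Hg : linear_growth G c).
  { intros r Hr v l; apply growth_le_ball; auto. }
  (* With [s] the integer part, 3s + 3 <= 30c^2 + 12c + 3, which is at most the claimed bound since
     c >= 1. *)
  destruct (nat_part (10 * c ^ 2 + 4 * c)) as [s [Hs1 Hs2]]; [nra|].
  exists (3 * s + 3)%nat; split.
  - rewrite plus_INR, mult_INR; simpl (INR 3); nra.
  - apply stack_layout_compactness; intros U.
    apply extends_layout_exists; [|simpl; lia|auto].
    intros W; destruct (balanced_separation_exists V G c W Hc Hg) as [X [As [HX HXA]]].
    exists X, As; split; [|assumption].
    apply Nat.lt_succ_r, INR_lt; rewrite S_INR; lra.
Qed.
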